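(* Let $d\in\{2,3\}$. The expected values of the radius of gyration on the equilateral arm and polygon spaces are $$E(\mathrm{Gyradius},\mathrm{eArm}_d(n))=\frac23\,\frac{n+2}{n(n+1)},\qquad E(\mathrm{Gyradius},\mathrm{ePol}_d(n))=\frac13\,\frac{n+1}{n^2}.$$
   Context: $\mathrm{eArm}_d(n)$ is the space of lists $(e_1,\dots,e_n)$ of vectors in $\mathbb{R}^d$ with $|e_i|=2/n$ for all $i$ (equilateral $n$-edge arms of total length $2$), i.e. the product of $n$ round spheres of dimension $d-1$ and radius $2/n$, with the product of the uniform probability measures. $\mathrm{ePol}_d(n)\subset\mathrm{eArm}_d(n)$ is the subspace of closed polygons, $\sum e_i=0$, with its subspace measure: the Riemannian volume measure of (the smooth part of) this subset as a submanifold of the product of round spheres, normalized to total mass $1$. $E(f,X)$ is the expectation of $f$ on $X$ with respect to these measures. The vertices of a polygon are $v_1$ (arbitrary) and $v_{m+1}=v_m+e_m$. The (squared) radius of gyration is half the average squared distance between vertices: for arms, $\mathrm{Gyradius}=\frac1{2(n+1)^2}\sum_{i,j=1}^{n+1}|v_i-v_j|^2$; for closed polygons, regarded as having $n$ vertices, $\mathrm{Gyradius}=\frac1{2n^2}\sum_{i,j=1}^{n}|v_i-v_j|^2$. *)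

(* Defs.v *)
(* MathComp / MathComp-Analysis *)
From HB Require Import structures.
From mathcomp Require Import all_boot all_order all_algebra.
From mathcomp Require Import all_classical all_reals all_analysis.
Set Implicit Arguments.
Unset Strict Implicit.
Unset Printing Implicit Defensive.
Import Order.TTheory GRing.Theory Num.Theory.
Import numFieldNormedType.Exports.
Local Open Scope classical_set_scope.
Local Open Scope ring_scope.

(* The library norm `|x| on 'rV[R]_n is the sup norm. *)
Definition enorm (R : realType) (n : nat) (x : 'rV[R]_n) : R :=
  Num.sqrt (\sum_(i < n) x 0 i ^+ 2).

Definition borel_rV (R : realType) (n : nat) :=
  g_sigma_algebraType (@open 'rV[R]_n).

(* Iterated one-dimensional Lebesgue integrals; by Tonelli this is the integral
   against k-dimensional Lebesgue measure for every nonnegative Borel f, which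
   is the only case used below. *)
Fixpoint int_rV (R : realType) (k : nat) : ('rV[R]_k -> \bar R) -> \bar R :=
  match k with
  | 0 => fun f => f 0
  | k'.+1 => fun f =>
      (\int[lebesgue_measure]_t
         int_rV (fun y : 'rV[R]_k' => f (row_mx (const_mx t : 'rV[R]_1) y)))%E
  end.

Fixpoint iter_partial (R : realType) (k N : nat) (s : seq 'I_k)
    (phi : 'rV[R]_k -> 'rV[R]_N) : 'rV[R]_k -> 'rV[R]_N :=
  match s with
  | [::] => phi
  | i :: s' => fun x => 'D_(delta_mx 0 i) (iter_partial s' phi) x
  end.

Definition smooth_on (R : realType) (k N : nat) (U : set 'rV[R]_k)
    (phi : 'rV[R]_k -> 'rV[R]_N) : Prop :=
  forall (s : seq 'I_k) (x : 'rV[R]_k),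
    U x -> differentiable (iter_partial s phi) x.

(* Smooth embedding of an open subset U of R^k onto a relatively open subset of
   M. Values of phi outside U are irrelevant. Row i of the Jacobian is the
   i-th partial derivative. *)
Record local_parametrization (R : realType) (k N : nat) (M : set 'rV[R]_N)
    (U : set 'rV[R]_k) (phi : 'rV[R]_k -> 'rV[R]_N) : Prop := {
  lp_open : open U ;
  lp_smooth : smooth_on U phi ;
  lp_immersion : forall x, U x -> row_free ('J phi x) ;
  lp_injective : forall x y, U x -> U y -> phi x = phi y -> x = y ;
  lp_homeomorphism : forall V : set 'rV[R]_k, open V -> V `<=` U ->
    exists2 W : set 'rV[R]_N, open W & phi @` V = M `&` W }.

(* The points near which M is a smooth embedded k-dimensional submanifold. *)
Definition smooth_part (R : realType) (k N : nat) (M : set 'rV[R]_N) :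
    set 'rV[R]_N :=
  [set p | exists (U : set 'rV[R]_k) (phi : 'rV[R]_k -> 'rV[R]_N),
     local_parametrization M U phi /\ (phi @` U) p].

(* vol is the volume measure of the metric induced on the smooth part of M by
   the Euclidean inner product: sqrt (det g) dx in local coordinates, with
   g = J J^T the Gram matrix of the partial derivatives. *)
Definition riemannian_volume (R : realType) (k N : nat) (M : set 'rV[R]_N)
    (vol : {measure set (borel_rV R N) -> \bar R}) : Prop :=
  vol.-negligible (~` smooth_part k M) /\
  forall (U : set 'rV[R]_k) (phi : 'rV[R]_k -> 'rV[R]_N) (B : set (borel_rV R N)),
    local_parametrization M U phi -> measurable B -> B `<=` phi @` U ->
    vol B = int_rV (fun x : 'rV[R]_k =>
      (\1_(U `&` phi @^-1` B) x * Num.sqrt (\det ('J phi x *m ('J phi x)^T)))%:E).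

(* Intended for M whose smooth part has a single dimension k; any other k makes
   the smooth part empty, hence vol = 0, and leaves no P. Likewise
   fine +oo = 0, so P forces the total volume to be finite and nonzero. *)
Definition normalized_volume (R : realType) (N : nat) (M : set 'rV[R]_N)
    (P : probability (borel_rV R N) R) : Prop :=
  exists (k : nat) (vol : {measure set (borel_rV R N) -> \bar R}),
    riemannian_volume k M vol /\
    forall A : set (borel_rV R N), measurable A ->
      P A = ((fine (vol setT))^-1%:E * vol A)%E.

Definition sphere (R : realType) (d : nat) (r : R) : set 'rV[R]_d :=
  [set x | enorm x = r].

(* A list of n vectors of R^d is flattened to a vector of R^(n * d). *)
Definition edge (R : realType) (n d : nat) (x : 'rV[R]_(n * d)) (i : 'I_n) :
    'rV[R]_d :=
  row i (vec_mx x).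

Definition eArm (R : realType) (n d : nat) : set 'rV[R]_(n * d) :=
  [set x | forall i : 'I_n, sphere (2%:R / n%:R) (edge x i)].

Definition ePol (R : realType) (n d : nat) : set 'rV[R]_(n * d) :=
  [set x | eArm x /\ \sum_(i < n) edge x i = 0].

Definition product_probability (R : realType) (n d : nat)
    (sigma : probability (borel_rV R d) R)
    (P : probability (borel_rV R (n * d)) R) : Prop :=
  forall A : 'I_n -> set (borel_rV R d), (forall i, measurable (A i)) ->
    P [set x | forall i : 'I_n, A i (edge x i)] = (\prod_(i < n) sigma (A i))%E.

Definition eArm_measure (R : realType) (n d : nat)
    (P : probability (borel_rV R (n * d)) R) : Prop :=
  exists sigma : probability (borel_rV R d) R,
    normalized_volume (sphere (2%:R / n%:R)) sigma /\ product_probability sigma P.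

(* The product metric on the product of round spheres is induced from
   R^(n * d), so the volume of the submanifold can be taken in R^(n * d). *)
Definition ePol_measure (R : realType) (n d : nat)
    (P : probability (borel_rV R (n * d)) R) : Prop :=
  normalized_volume (@ePol R n d) P.

(* Vertices are numbered from 0: vertex v1 x 0 = v1. *)
Definition vertex (R : realType) (n d : nat) (v1 : 'rV[R]_d)
    (x : 'rV[R]_(n * d)) (m : nat) : 'rV[R]_d :=
  v1 + \sum_(i < n | (i < m)%N) edge x i.

Definition gyradius (R : realType) (n d m : nat) (v1 : 'rV[R]_d)
    (x : 'rV[R]_(n * d)) : R :=
  (2%:R * m%:R ^+ 2)^-1 *
  \sum_(i < m) \sum_(j < m) enorm (vertex v1 x i - vertex v1 x j) ^+ 2.

Definition arm_gyradius (R : realType) (n d : nat) (v1 : 'rV[R]_d) :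
    borel_rV R (n * d) -> R :=
  @gyradius R n d n.+1 v1.

Definition pol_gyradius (R : realType) (n d : nat) (v1 : 'rV[R]_d) :
    borel_rV R (n * d) -> R :=
  @gyradius R n d n v1.

(* Main.v *)
(* Both expectations follow from the symmetries of the measures. If Q is an
   orthogonal matrix preserving M, then composing a local parametrization of M
   with Q gives another one with the same Gram matrix, so the Riemannian volume
   of M is Q-invariant (the smooth part being covered by countably many charts).
   Applied to - 1 on the sphere, this shows that flipping one edge of a random
   arm preserves the law, so E<e_k, e_l> = 0 for k <> l. Applied to permutations
   of the edges of a closed polygon, it shows that E<e_k, e_l> = c does not
   depend on k <> l, and sum e_l = 0 forces c = - (2 / n)^2 / (n - 1). As
   |e_k| = 2 / n, in both cases E|v_i - v_j|^2 = (a - c) |i - j| + c (i - j)^2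
   with a = (2 / n)^2, and it remains to sum over i and j. *)
Require Import Defs.
From mathcomp Require Import all_boot all_order all_algebra.
From mathcomp Require Import perm.
From mathcomp Require Import all_classical all_reals all_analysis.
From mathcomp Require Import measurable_realfun ring lra zify.
Import Order.TTheory GRing.Theory Num.Theory.
Import numFieldNormedType.Exports.
Local Open Scope classical_set_scope.
Local Open Scope ring_scope.
Set Implicit Arguments.
Unset Strict Implicit.
Unset Printing Implicit Defensive.

(** * Orthogonal maps and Riemannian volume *)

Lemma continuous_mx (R : realType) (T : topologicalType) (m n : nat)
    (f : T -> 'M[R]_(m, n)) :
  (forall i j, continuous (fun x => f x i j)) -> continuous f.
Proof.
move=> cf x A [P fP sPA].
have : \forall y \near x, forall ij : 'I_m * 'I_n, P ij.1 ij.2 (f y ij.1 ij.2).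
  apply: filter_forall => -[i j] /=.
  exact: (cf i j x).
by apply: filterS => y Py; apply: sPA => i j; exact: (Py (i, j)).
Qed.

Lemma continuous_sum (R : realType) (T : topologicalType) (I : Type)
    (s : seq I) (f : I -> T -> R) :
  (forall i, continuous (f i)) -> continuous (fun x => \sum_(i <- s) f i x).
Proof.
move=> cf; elim: s => [|i s IHs] x.
  under eq_fun do rewrite big_nil.
  exact: cvg_cst.
under eq_fun do rewrite big_cons.
by apply: cvgD; [exact: cf|exact: IHs].
Qed.

Lemma continuous_mulmxr (R : realType) (m n p : nat) (Q : 'M[R]_(n, p)) :
  continuous (fun x : 'M[R]_(m, n) => x *m Q).
Proof.
apply: continuous_mx => i j.
under eq_fun do rewrite mxE.
apply: continuous_sum => k x.
have cx := @coord_continuous R m n i k x.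
exact: (cvgM cx (cvg_cst _)).
Qed.

Lemma differentiable_mulmxr (R : realType) (k N : nat) (Q : 'M[R]_N)
    (f : 'rV[R]_k -> 'rV[R]_N) (x : 'rV[R]_k) :
  differentiable f x -> differentiable (fun y => f y *m Q) x.
Proof.
move=> df; apply: (@differentiable_comp _ _ _ _ f (mulmxr Q)) => //.
by apply: linear_differentiable; exact: continuous_mulmxr.
Qed.

Lemma diff_mulmxr (R : realType) (k N : nat) (Q : 'M[R]_N)
    (f : 'rV[R]_k -> 'rV[R]_N) (x v : 'rV[R]_k) :
  differentiable f x -> 'd (fun y => f y *m Q) x v = 'd f x v *m Q.
Proof.
move=> df.
have cQ : continuous (mulmxr Q : 'rV[R]_N -> 'rV[R]_N).
  exact: continuous_mulmxr.
have dQ := linear_differentiable (f x) cQ.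
have := diff_comp df dQ; rewrite diff_lin// => E.
by have := congr1 (fun g => g v) E.
Qed.

Lemma derive_mulmxr (R : realType) (k N : nat) (Q : 'M[R]_N)
    (f : 'rV[R]_k -> 'rV[R]_N) (x v : 'rV[R]_k) :
  differentiable f x -> 'D_v (fun y => f y *m Q) x = 'D_v f x *m Q.
Proof.
move=> df; have E := deriveE v (differentiable_mulmxr Q df).
by rewrite (diff_mulmxr _ _ df) -(deriveE v df) in E.
Qed.

Lemma jacobian_mulmxr (R : realType) (k N : nat) (Q : 'M[R]_N)
    (f : 'rV[R]_k -> 'rV[R]_N) (x : 'rV[R]_k) :
  differentiable f x -> 'J (fun y => f y *m Q) x = 'J f x *m Q.
Proof.
move=> df; apply/row_matrixP => i.
have Eg := deriveEjacobian (delta_mx 0 i) (differentiable_mulmxr Q df).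
have Ef := deriveEjacobian (delta_mx 0 i) df.
rewrite (derive_mulmxr _ _ df) Ef in Eg.
rewrite (rowE i ('J (fun y => f y *m Q) x)) (rowE i ('J f x *m Q)).
by rewrite -Eg mulmxA.
Qed.

(** The difference [g - f] vanishes near [x], so it has differential zero there, and
    [g = f + (g - f)]. *)
Lemma near_eq_differentiable (R : realType) (V W : normedModType R)
    (f g : V -> W) (x : V) :
  (\near x, f x = g x) -> differentiable f x -> differentiable g x.
Proof.
move=> fg df.
have h0 : (g - f) \o shift x = cst ((g - f) x) + (\0 : V -> W) +o_ 0 id.
  apply/eqaddoP => e e0.
  have hn : \forall y \near x, (g - f) y = 0.
    by apply: filterS fg => y fgy; rewrite fctE -fgy subrr.
  move: (hn); rewrite (near_shift 0) subr0 => hn0.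
  apply: filterS hn0 => y hy.
  have -> : ((g - f) \o shift x - (cst ((g - f) x) + \0)) y =
    (g - f) (y + x) - ((g - f) x + 0) by [].
  rewrite (nbhs_singleton hn) [X in X - _]hy addr0 subr0 normr0.
  by rewrite mulr_ge0// ltW.
have dh : 'd (g - f) x = \0 :> (V -> W).
  by apply: diff_unique => //; exact: cst_continuous.
have -> : g = f + (g - f) by apply/funext => y; rewrite !fctE addrC subrK.
apply: differentiableD => //; apply/diff_locallyP; rewrite dh; split => //.
exact: cst_continuous.
Qed.

(** Equality is claimed on [U] only, since smoothness says nothing elsewhere. Because [U] is open,
    the equality holds near each of its points and so survives the next partial derivative. *)
Lemma iter_partial_mulmxr (R : realType) (k N : nat) (Q : 'M[R]_N)
    (U : set 'rV[R]_k) (phi : 'rV[R]_k -> 'rV[R]_N) (s : seq 'I_k) :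
  open U -> smooth_on U phi ->
  {in U, iter_partial s (fun y => phi y *m Q) =1
         fun y => iter_partial s phi y *m Q}.
Proof.
move=> oU sphi; elim: s => [|i s IHs] x //= /set_mem Ux.
have nE : \near x, iter_partial s (fun y => phi y *m Q) x =
                   iter_partial s phi x *m Q.
  apply: filterS (open_nbhs_nbhs (conj oU Ux)) => y Uy.
  by apply: IHs; exact/mem_set.
rewrite (near_eq_derive _ nE).
exact: derive_mulmxr (sphi s x Ux).
Qed.

Lemma smooth_on_mulmxr (R : realType) (k N : nat) (Q : 'M[R]_N)
    (U : set 'rV[R]_k) (phi : 'rV[R]_k -> 'rV[R]_N) :
  open U -> smooth_on U phi -> smooth_on U (fun y => phi y *m Q).
Proof.
move=> oU sphi s x Ux.
apply: (@near_eq_differentiable _ _ _ (fun y => iter_partial s phi y *m Q)).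
  apply: filterS (open_nbhs_nbhs (conj oU Ux)) => y Uy; apply/esym.
  by apply: (iter_partial_mulmxr Q s oU sphi) => //; exact/mem_set.
by apply: differentiable_mulmxr; exact: sphi.
Qed.

(** Right multiplication by [Q] is an invertible linear map with inverse [Q^T] that maps [M] onto
    itself. Rank and injectivity are therefore kept, and a relatively open image is cut out by the
    preimage of [W] under [Q^T]. *)
Lemma local_parametrization_mulmxr (R : realType) (k N : nat) (Q : 'M[R]_N)
    (M : set 'rV[R]_N) (U : set 'rV[R]_k) (phi : 'rV[R]_k -> 'rV[R]_N) :
  Q *m Q^T = 1%:M -> (forall x, M (x *m Q) <-> M x) ->
  local_parametrization M U phi ->
  local_parametrization M U (fun y => phi y *m Q).
Proof.
move=> QQ MQ [oU sU iU jU hU].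
have QtQ : Q^T *m Q = 1%:M by exact: mulmx1C.
have QK (x : 'rV_N) : x *m Q *m Q^T = x by rewrite -mulmxA QQ mulmx1.
have QtK (x : 'rV_N) : x *m Q^T *m Q = x by rewrite -mulmxA QtQ mulmx1.
split.
- exact: oU.
- exact: smooth_on_mulmxr.
- move=> x Ux; rewrite jacobian_mulmxr; last exact: (sU [::] x Ux).
  have := iU x Ux; rewrite /row_free mxrankMfree//.
  by rewrite row_free_unit; have [] := mulmx1_unit QQ.
- move=> x y Ux Uy xy; apply: (jU x y Ux Uy).
  by rewrite -(QK (phi x)) xy QK.
- move=> V oV VU; have [W oW phiV] := hU V oV VU.
  exists ((fun x => x *m Q^T) @^-1` W).
    by apply: open_comp => // x _; exact: continuous_mulmxr.
  apply/seteqP; split=> [_ [x Vx <-]|y [My Wy]] /=.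
    have [Mx Wx] : (M `&` W) (phi x) by rewrite -phiV; exists x.
    by split; [apply/MQ|rewrite /= QK].
  have [x Vx xy] : (phi @` V) (y *m Q^T).
    by rewrite phiV; split=> //; apply/MQ; rewrite QtK.
  by exists x => //; rewrite xy QtK.
Qed.

(** * Rational balls and Borel measurability *)

Definition rat_ball (R : realType) (N : nat) (c : 'rV[rat]_N * nat) :
    set 'rV[R]_N :=
  ball (map_mx ratr c.1 : 'rV[R]_N) c.2.+1%:R^-1.

Arguments rat_ball R {N} c.

(** Take a radius [r = 1 / (m + 1)] below [e / 2] and, coordinate by coordinate, a rational centre
    within [r] of [x]. The resulting ball contains [x] and lies in the ball of radius [r + r] about
    [x]. Its index ranges over a countable type. *)
Lemma rat_ball_basis (R : realType) (N : nat) (x : 'rV[R]_N)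
    (A : set 'rV[R]_N) :
  nbhs x A -> exists c, rat_ball R c x /\ rat_ball R c `<=` A.
Proof.
move=> /nbhs_ballP[e /= e0 eA].
have [m] : exists m, 0 + m.+1%:R^-1 < e / 2 :> R.
  by apply: ltr_add_invr; rewrite divr_gt0.
rewrite add0r => me; set r := m.+1%:R^-1 in me.
have r0 : 0 < r :> R by rewrite invr_gt0.
have /choice[q qx] : forall j : 'I_N, exists q : rat,
    x 0 j - r < ratr q < x 0 j + r.
  move=> j; have [|q] := @rat_in_itvoo R (x 0 j - r) (x 0 j + r).
    by rewrite ltrBlDr -addrA ltrDl addr_gt0.
  by rewrite in_itv /= => ?; exists q.
have xc : rat_ball R (\row_j q j, m) x.
  split=> // i j; rewrite (ord1 i) !mxE /= /ball /=.
  have /andP[h1 h2] := qx j.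
  by rewrite ltr_norml; apply/andP; split; rewrite -/r; lra.
exists (\row_j q j, m); split=> // y cy; apply: eA.
apply: (@le_ball _ _ x (r + r)); first by rewrite (splitr e) lerD// ltW.
by apply: ball_triangle cy; exact: ball_sym.
Qed.

(** Balls not contained in [A] are replaced by [set0], so that the union runs over the whole
    countable index type. *)
Lemma open_bigcup_rat_ball (R : realType) (N : nat) (A : set 'rV[R]_N) :
  open A ->
  A = \bigcup_c (if `[< rat_ball R c `<=` A >] then rat_ball R c else set0).
Proof.
move=> oA; apply/seteqP; split=> [x Ax|x [c _]].
  have [c [cx cA]] := rat_ball_basis (open_nbhs_nbhs (conj oA Ax)).
  by exists c => //; case: asboolP.
by case: asboolP => // + cx; apply.
Qed.

Lemma open_measurable_rV (R : realType) (N : nat) (A : set (borel_rV R N)) :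
  @open 'rV[R]_N A -> measurable A.
Proof. exact: sub_sigma_algebra. Qed.

Lemma closed_measurable_rV (R : realType) (N : nat) (A : set (borel_rV R N)) :
  @closed 'rV[R]_N A -> measurable A.
Proof.
move=> cA; rewrite -(setCK A); apply: measurableC; apply: open_measurable_rV.
exact: closed_openC.
Qed.

Lemma continuous_measurable_rV (R : realType) (m n : nat)
    (f : 'rV[R]_m -> 'rV[R]_n) :
  continuous f ->
  measurable_fun [set: borel_rV R m] (f : borel_rV R m -> borel_rV R n).
Proof.
move=> cf.
apply: (@measurability _ _ (borel_rV R m) (borel_rV R n) setT f
  (@open 'rV[R]_n)) => //.
move=> _ [B oB <-]; rewrite setTI; apply: open_measurable_rV.
by apply: open_comp => // x _; exact: cf.
Qed.

Lemma continuous_measurable_rV_R (R : realType) (m : nat) (f : 'rV[R]_m -> R) :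
  continuous f -> measurable_fun [set: borel_rV R m] (f : borel_rV R m -> R).
Proof.
move=> cf; apply: (measurability _ (RGenOpens.measurableE R)).
move=> _ [_ [a [b ->] <-]]; rewrite setTI; apply: open_measurable_rV.
by apply: open_comp => [x _|]; [exact: cf|exact: interval_open].
Qed.

Definition mulmxr_borel (R : realType) (N : nat) (Q : 'M[R]_N)
    (x : borel_rV R N) : borel_rV R N := (x : 'rV[R]_N) *m Q.

Lemma measurable_mulmxr_borel (R : realType) (N : nat) (Q : 'M[R]_N) :
  measurable_fun [set: borel_rV R N] (mulmxr_borel Q).
Proof. exact: (continuous_measurable_rV (@continuous_mulmxr _ _ _ _ Q)). Qed.

Lemma measurable_preimage_mulmxr (R : realType) (N : nat) (Q : 'M[R]_N)
    (B : set (borel_rV R N)) :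
  measurable B -> measurable (mulmxr_borel Q @^-1` B).
Proof.
by move=> mB; rewrite -[X in measurable X]setTI; exact: measurable_mulmxr_borel.
Qed.

(** * Invariance of Riemannian volume under orthogonal symmetries *)

Lemma gram_mulmxr (R : realType) (k N : nat) (Q : 'M[R]_N)
    (phi : 'rV[R]_k -> 'rV[R]_N) (x : 'rV[R]_k) :
  Q *m Q^T = 1%:M -> differentiable phi x ->
  'J (fun y => phi y *m Q) x *m ('J (fun y => phi y *m Q) x)^T =
  'J phi x *m ('J phi x)^T.
Proof.
move=> QQ dphi; rewrite (jacobian_mulmxr Q dphi).
by rewrite trmx_mul mulmxA -(mulmxA ('J phi x) Q Q^T) QQ mulmx1.
Qed.

(* The preimage of B is charted by phi Q^T, with the same integrand. *)
Lemma riemannian_volume_patch (R : realType) (k N : nat) (Q : 'M[R]_N)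
    (M : set 'rV[R]_N) (vol : {measure set (borel_rV R N) -> \bar R})
    (U : set 'rV[R]_k) (phi : 'rV[R]_k -> 'rV[R]_N) (B : set (borel_rV R N)) :
  Q *m Q^T = 1%:M -> (forall x, M (x *m Q) <-> M x) ->
  riemannian_volume k M vol -> local_parametrization M U phi ->
  measurable B -> B `<=` phi @` U ->
  vol (mulmxr_borel Q @^-1` B) = vol B.
Proof.
move=> QQ MQ [_ vE] Uphi mB BU.
have QtQ : Q^T *m Q = 1%:M by exact: mulmx1C.
have QK (x : 'rV_N) : x *m Q *m Q^T = x by rewrite -mulmxA QQ mulmx1.
have QtK (x : 'rV_N) : x *m Q^T *m Q = x by rewrite -mulmxA QtQ mulmx1.
have UphiQ : local_parametrization M U (fun y => phi y *m Q^T).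
  apply: local_parametrization_mulmxr => //; first by rewrite trmxK.
  by move=> x; rewrite -{2}(QtK x) MQ.
rewrite (vE _ _ _ Uphi mB BU) (vE _ _ _ UphiQ); last 2 first.
- exact: measurable_preimage_mulmxr.
- move=> x Bx; have [y Uy yx] := BU _ Bx.
  by exists y => //; rewrite yx /mulmxr_borel QK.
apply: (congr1 (@int_rV R k)); apply/funext => x.
rewrite (_ : U `&` _ = U `&` phi @^-1` B); last first.
  by apply/seteqP; split=> y [Uy]; rewrite /= /mulmxr_borel QtK.
(* The Gram matrices agree where [phi] is differentiable, that is on [U]; off [U] the indicator
   makes both integrands zero. *)
have [Ux|nUx] := pselect (U x).
  have dphi : differentiable phi x := lp_smooth Uphi [::] Ux.
  have QtQt : Q^T *m Q^T^T = 1%:M by rewrite trmxK.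
  pose c := \1_(U `&` phi @^-1` B) x : R.
  have G := gram_mulmxr QtQt dphi.
  exact (congr1 (fun A : 'M[R]_k => (c * Num.sqrt (\det A))%:E) G).
have mul0 (c a b : R) : c = 0 -> (c * a)%:E = (c * b)%:E.
  by move=> ->; rewrite !mul0r.
by apply: mul0; rewrite indicE memNset// => -[].
Qed.

Lemma smooth_part_sub (R : realType) (k N : nat) (M : set 'rV[R]_N) :
  smooth_part k M `<=` M.
Proof.
move=> p [U [phi [Uphi]]].
have [W _ ->] := lp_homeomorphism Uphi (lp_open Uphi) (@subset_refl _ U).
by case.
Qed.

(** The volume is known explicitly only inside one chart. The smooth part is therefore cut into
    countably many disjoint measurable pieces, each inside a chart image; invariance holds on each
    piece, and countable additivity sums the pieces. *)
Lemma riemannian_volume_mulmxr (R : realType) (k N : nat) (Q : 'M[R]_N)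
    (M : set 'rV[R]_N) (vol : {measure set (borel_rV R N) -> \bar R})
    (A : set (borel_rV R N)) :
  Q *m Q^T = 1%:M -> (forall x, M (x *m Q) <-> M x) -> closed M ->
  riemannian_volume k M vol -> measurable A ->
  vol (mulmxr_borel Q @^-1` A) = vol A.
Proof.
move=> QQ MQ cM volM mA; set tau := mulmxr_borel Q.
have mtau B : measurable B -> measurable (tau @^-1` B).
  exact: measurable_preimage_mulmxr.
pose in_patch B := exists (U : set 'rV[R]_k) phi,
  local_parametrization M U phi /\ B `<=` phi @` U.
(* [D] enumerates the sets [M] meets rational ball that fit in a single chart image, with [set0] for
   the other indices. *)
pose D n : set (borel_rV R N) :=
  if @unpickle ('rV[rat]_N * nat)%type n is Some c then
    if `[< in_patch (M `&` rat_ball R c) >] then M `&` rat_ball R c else set0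
  else set0.
have mD n : measurable (D n).
  rewrite /D; case: unpickle => [c|]//; case: ifP => // _.
  apply: measurableI; first exact: closed_measurable_rV.
  by apply: open_measurable_rV; exact: ball_open.
have pD n : D n = set0 \/ in_patch (D n).
  rewrite /D; case: unpickle => [c|]; last by left.
  by case: asboolP => ?; [right|left].
have SD : smooth_part k M = \bigcup_n D n.
  apply/seteqP; split=> [p Sp|p [n _]].
    have [U [phi [Uphi Up]]] := Sp.
    have [W oW phiU] := lp_homeomorphism Uphi (lp_open Uphi) (@subset_refl _ U).
    have [_ Wp] : (M `&` W) p by rewrite -phiU.
    have [c [cp cW]] := rat_ball_basis (open_nbhs_nbhs (conj oW Wp)).
    exists (pickle c) => //; rewrite /D pickleK asboolT.
      by split=> //; exact: smooth_part_sub Sp.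
    by exists U, phi; split=> //; rewrite phiU; exact: setIS.
  by case: (pD n) => [->//|[U [phi [Uphi DU]]]] /DU ?; exists U, phi.
have mS : measurable (smooth_part k M : set (borel_rV R N)).
  by rewrite SD; exact: bigcupT_measurable.
have volS0 : vol (~` smooth_part k M) = 0.
  by apply/negligibleP; [exact: measurableC|exact: volM.1].
(* Composing a chart with [Q] shows that [tau] sends smooth points to smooth points. This inclusion
   suffices, since [volE] below accepts any measurable set containing the smooth part. *)
have SQ : smooth_part k M `<=` tau @^-1` smooth_part k M.
  move=> _ [U [phi [Uphi [x Ux <-]]]]; exists U, (fun y => tau (phi y)).
  by split; [exact: local_parametrization_mulmxr|exists x].
have volE (S B : set (borel_rV R N)) : measurable S -> measurable B ->
    smooth_part k M `<=` S -> vol B = vol (B `&` S).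
  move=> mS' mB sS; rewrite (measureDI vol mB mS').
  rewrite [X in (X + _)%E](_ : _ = 0) ?add0e//.
  apply: (@subset_measure0 _ _ _ vol _ (~` smooth_part k M)) => //.
  - exact: measurableD.
  - exact: measurableC.
  - by move=> x [_ nSx] /sS.
(* [seqDU] makes the patches disjoint without changing their union, and each only shrinks, so it
   stays in its chart. *)
have mF := seqDU_measurable mD.
have pF n : seqDU D n = set0 \/ in_patch (seqDU D n).
  have [D0|[U [phi [Uphi DU]]]] := pD n.
    by left; rewrite /seqDU D0 set0D.
  by right; exists U, phi; split=> // x [Dx _]; exact: DU.
rewrite (volE _ _ (mtau _ mS) (mtau _ mA) SQ).
rewrite (volE _ _ mS mA (@subset_refl _ _)).
rewrite SD seqDU_bigcup_eq preimage_bigcup !setI_bigcupr.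
rewrite !measure_bigcup//; last 4 first.
- by move=> n _; exact: measurableI.
- exact/trivIset_setIl/trivIset_seqDU.
- by move=> n _; apply: measurableI; exact: mtau.
- apply: trivIset_setIl => i j _ _ [x [Fi Fj]].
  by apply: (@trivIset_seqDU _ D i j) => //; exists (tau x).
apply: eq_eseriesr => n _; rewrite -preimage_setI.
have [->|[U [phi [Uphi FU]]]] := pF n; first by rewrite setI0 preimage_set0.
apply: (riemannian_volume_patch QQ MQ volM Uphi); first exact: measurableI.
exact: subset_trans (@subIsetr _ _ _) FU.
Qed.

Lemma normalized_volume_mulmxr (R : realType) (N : nat) (Q : 'M[R]_N)
    (M : set 'rV[R]_N) (P : probability (borel_rV R N) R)
    (A : set (borel_rV R N)) :
  Q *m Q^T = 1%:M -> (forall x, M (x *m Q) <-> M x) -> closed M ->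
  normalized_volume M P -> measurable A ->
  P (mulmxr_borel Q @^-1` A) = P A.
Proof.
move=> QQ MQ cM [k [vol [volM PE]]] mA.
rewrite !PE ?(riemannian_volume_mulmxr QQ MQ cM volM)//.
exact: measurable_preimage_mulmxr.
Qed.

(** The complement of [M] lies in the complement of the smooth part, which is negligible by
    definition of the volume. *)
Lemma normalized_volume_support (R : realType) (N : nat) (M : set 'rV[R]_N)
    (P : probability (borel_rV R N) R) :
  closed M -> normalized_volume M P -> P (~` M) = 0.
Proof.
move=> cM [k [vol [[volS _] PE]]].
have mM : measurable (M : set (borel_rV R N)) by exact: closed_measurable_rV.
have mMC := measurableC mM.
rewrite PE//; have -> : vol (~` M) = 0; last by rewrite mule0.
apply/(negligibleP _ mMC).
by apply: negligibleS volS; apply: subsetC; exact: smooth_part_sub.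
Qed.

(** * Sums over vertices and edges *)

(** This is the induction step for the two double sums below: the last row and the last column
    contribute equally, and the corner vanishes. *)
Lemma sum_sym_square (V : nmodType) (F : nat -> nat -> V) (m : nat) :
  (forall a b, F a b = F b a) -> (forall a, F a a = 0) ->
  \sum_(a < m.+1) \sum_(b < m.+1) F a b =
  \sum_(a < m) \sum_(b < m) F a b + (\sum_(a < m) F a m) *+ 2.
Proof.
move=> FC F0; rewrite big_ord_recr /=.
under eq_bigr do rewrite big_ord_recr /=.
rewrite big_split /= big_ord_recr /= F0 addr0 -addrA mulr2n.
by congr (_ + (_ + _)); apply: eq_bigr => a _.
Qed.

(** The summand is the distance between [a] and [b], in the form produced by
    [sum_step_weight_sqr]. *)
Lemma sum_dist (R : realFieldType) (m : nat) :
  \sum_(a < m) \sum_(b < m) (a%:R + b%:R - 2 * (minn a b)%:R) =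
  m%:R * (m%:R ^+ 2 - 1) / 3 :> R.
Proof.
have row (M : R) p : \sum_(a < p) (M - a%:R) = p%:R * M - p%:R * (p%:R - 1) / 2.
  elim: p => [|p IHp]; first by rewrite big_ord0; field.
  by rewrite big_ord_recr IHp /= -natr1; field.
elim: m => [|m IHm]; first by rewrite big_ord0; field.
rewrite (sum_sym_square (F := fun a b => a%:R + b%:R - 2 * (minn a b)%:R));
  last 2 first.
- by move=> a b; rewrite minnC (addrC a%:R).
- by move=> a; rewrite minnn; ring.
rewrite IHm (eq_bigr (fun a : 'I_m => m%:R - a%:R)); last first.
  by move=> a _; rewrite (minn_idPl (ltnW (ltn_ord a))); ring.
by rewrite row -natr1; field.
Qed.

Lemma sum_dist_sqr (R : realFieldType) (m : nat) :
  \sum_(a < m) \sum_(b < m) (a%:R - b%:R) ^+ 2 =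
  m%:R ^+ 2 * (m%:R ^+ 2 - 1) / 6 :> R.
Proof.
have row (M : R) p : \sum_(a < p) (a%:R - M) ^+ 2 =
    p%:R * M ^+ 2 - M * p%:R * (p%:R - 1) +
    p%:R * (p%:R - 1) * (2 * p%:R - 1) / 6.
  elim: p => [|p IHp]; first by rewrite big_ord0; field.
  by rewrite big_ord_recr IHp /= -natr1; field.
elim: m => [|m IHm]; first by rewrite big_ord0; field.
rewrite (sum_sym_square (F := fun a b => (a%:R - b%:R) ^+ 2)); last 2 first.
- by move=> a b; ring.
- by move=> a; rewrite subrr expr0n.
by rewrite IHm row -natr1; field.
Qed.

Lemma sum_ltn (n a : nat) : (\sum_(k < n) (k < a) = minn n a)%N.
Proof.
elim: n => [|n IHn]; first by rewrite big_ord0 min0n.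
by rewrite big_ord_recr IHn /=; lia.
Qed.

Section step_weight.
Variable R : realFieldType.

(* v_a - v_b = \sum_k step_weight a b k *: e_k *)
Definition step_weight (a b k : nat) : R := (k < a)%N%:R - (k < b)%N%:R.

Lemma sum_step_weight (n a b : nat) : (a <= n)%N -> (b <= n)%N ->
  \sum_(k < n) step_weight a b k = a%:R - b%:R.
Proof.
move=> an bn; rewrite sumrB -!natr_sum !sum_ltn.
by rewrite (minn_idPr an) (minn_idPr bn).
Qed.

(** For p, q in {0, 1} one has (p - q)^2 = p + q - 2pq, and the product of the indicators of [k < a]
    and [k < b] is that of [k < minn a b]. *)
Lemma sum_step_weight_sqr (n a b : nat) : (a <= n)%N -> (b <= n)%N ->
  \sum_(k < n) step_weight a b k ^+ 2 = a%:R + b%:R - 2 * (minn a b)%:R.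
Proof.
move=> an bn.
rewrite (eq_bigr (fun k : 'I_n =>
    (k < a)%N%:R + (k < b)%N%:R - 2 * (k < minn a b)%N%:R)); last first.
  move=> k _; rewrite /step_weight leq_min.
  by case: (k < a)%N; case: (k < b)%N; rewrite /=; ring.
rewrite sumrB big_split /= -mulr_sumr -!natr_sum !sum_ltn.
rewrite (minn_idPr an) (minn_idPr bn) (minn_idPr _)//.
by rewrite geq_min an.
Qed.

(** For fixed [i] and [j], the quadratic form with [a] on the diagonal and [c] off it is [a - c]
    times the sum of the squared weights plus [c] times the square of their sum. The bound on [m]
    keeps vertex indices at most [n]. *)
Lemma sum_step_weight_quadratic (n m : nat) (a c : R) : (m <= n.+1)%N ->
  \sum_(i < m) \sum_(j < m) \sum_(k < n) \sum_(l < n)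
    step_weight i j k * step_weight i j l * (if k == l then a else c) =
  (a - c) * (m%:R * (m%:R ^+ 2 - 1) / 3) +
  c * (m%:R ^+ 2 * (m%:R ^+ 2 - 1) / 6).
Proof.
move=> mn; rewrite -sum_dist -sum_dist_sqr !mulr_sumr -big_split /=.
apply: eq_bigr => i _; rewrite !mulr_sumr -big_split /=.
apply: eq_bigr => j _.
have im : (i <= n)%N by rewrite -ltnS (leq_trans (ltn_ord i)).
have jm : (j <= n)%N by rewrite -ltnS (leq_trans (ltn_ord j)).
rewrite -(sum_step_weight_sqr im jm) -(sum_step_weight im jm) expr2.
rewrite mulr_suml !mulr_sumr -big_split /=; apply: eq_bigr => k _.
rewrite !mulr_sumr (bigD1 k)//= [in RHS](bigD1 k)//= eqxx.
rewrite (eq_bigr (fun l : 'I_n => c * (step_weight i j k * step_weight i j l))).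
  by ring.
by move=> l /negPf; rewrite eq_sym => ->; ring.
Qed.

End step_weight.

(** * Inner products of edges *)

Section edges.
Variables (R : realType) (n d : nat).
Implicit Types (x : 'rV[R]_(n * d)) (i j k l : 'I_n).

Definition edge_dot (i j : 'I_n) (x : 'rV[R]_(n * d)) : R :=
  \sum_(t < d) edge x i 0 t * edge x j 0 t.

Lemma edgeE x i t : edge x i 0 t = x 0 (mxvec_index i t).
Proof. by rewrite /edge !mxE. Qed.

Lemma sqr_enorm (y : 'rV[R]_d) : enorm y ^+ 2 = \sum_(t < d) y 0 t ^+ 2.
Proof. by rewrite sqr_sqrtr// sumr_ge0// => t _; exact: sqr_ge0. Qed.

Lemma edge_dot_diag i x : edge_dot i i x = enorm (edge x i) ^+ 2.
Proof. by rewrite sqr_enorm; apply: eq_bigr => t _; rewrite expr2. Qed.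

Lemma vertex_sub (v1 : 'rV[R]_d) x a b :
  vertex v1 x a - vertex v1 x b = \sum_(k < n) step_weight R a b k *: edge x k.
Proof.
rewrite /vertex opprD addrACA subrr add0r.
rewrite [X in X - _]big_mkcond [X in _ - X]big_mkcond -sumrB.
apply: eq_bigr => k _; rewrite /step_weight.
by case: (k < a)%N; case: (k < b)%N;
  rewrite /= ?subrr ?subr0 ?sub0r ?scale0r ?scaleN1r ?scale1r.
Qed.

Lemma enorm_sum_edge (w : 'I_n -> R) x :
  enorm (\sum_(k < n) w k *: edge x k) ^+ 2 =
  \sum_(k < n) \sum_(l < n) w k * w l * edge_dot k l x.
Proof.
rewrite sqr_enorm.
under eq_bigr do rewrite summxE expr2 mulr_suml.
rewrite exchange_big /=; apply: eq_bigr => k _.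
under eq_bigr do rewrite mulr_sumr.
rewrite exchange_big /=; apply: eq_bigr => l _.
rewrite /edge_dot mulr_sumr; apply: eq_bigr => t _.
by rewrite ![(_ *: edge x _) 0 t]mxE; ring.
Qed.

(** As a finite linear combination of inner products of edges, the gyradius has an expectation
    determined by theirs. *)
Lemma gyradiusE (m : nat) (v1 : 'rV[R]_d) x :
  gyradius m v1 x = \sum_(i < m) \sum_(j < m) \sum_(k < n) \sum_(l < n)
    (2 * m%:R ^+ 2)^-1 * (step_weight R i j k * step_weight R i j l) *
    edge_dot k l x.
Proof.
rewrite /gyradius mulr_sumr; apply: eq_bigr => i _.
rewrite mulr_sumr; apply: eq_bigr => j _.
rewrite vertex_sub enorm_sum_edge mulr_sumr; apply: eq_bigr => k _.
by rewrite mulr_sumr; apply: eq_bigr => l _; rewrite mulrA.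
Qed.

Lemma continuous_edge_coord i t : continuous (fun x => edge x i 0 t).
Proof. under eq_fun do rewrite edgeE; exact: coord_continuous. Qed.

Lemma continuous_edge i : continuous (fun x => edge x i : 'rV[R]_d).
Proof.
by apply: continuous_mx => p t; rewrite (ord1 p); exact: continuous_edge_coord.
Qed.

Lemma continuous_edge_dot i j : continuous (edge_dot i j).
Proof.
apply: continuous_sum => t x.
exact: (cvgM (@continuous_edge_coord i t x) (@continuous_edge_coord j t x)).
Qed.

Lemma continuous_enorm : continuous (@enorm R d).
Proof.
move=> y; apply: continuous_comp; last exact: sqrt_continuous.
apply: continuous_sum => t z.
have cz := @coord_continuous R 1 _ 0 t z.
exact: (cvgM cz cz).
Qed.

Lemma closed_sphere (r : R) : closed (sphere r : set 'rV[R]_d).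
Proof.
apply: (@preimage_closed _ _ (@enorm R d) [set y | y = r]) => [y _|].
  exact: continuous_enorm.
exact: closed_eq.
Qed.

(** A crude bound, meant for integrability: each of the [d] coordinates of an edge is at most its
    length [2 / n] in absolute value. *)
Lemma edge_dot_eArm i j x : eArm x ->
  `|edge_dot i j x| <= d%:R * (2 / n%:R) ^+ 2.
Proof.
move=> ax.
have r0 : 0 <= 2 / n%:R :> R by rewrite divr_ge0.
have xr k t : `|edge x k 0 t| <= 2 / n%:R.
  rewrite -(ger0_norm r0) -ler_sqr ?nnegrE// !real_normK ?num_real//.
  rewrite -[2 / n%:R](ax k) sqr_enorm (bigD1 t)//= lerDl sumr_ge0// => s _.
  exact: sqr_ge0.
apply: le_trans (ler_norm_sum _ _ _) _.
rewrite -[X in X%:R * _]card_ord -sum1_card natr_sum mulr_suml.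
by apply: ler_sum => t _; rewrite mul1r normrM expr2 ler_pM.
Qed.

End edges.

(** * Orthogonal matrices acting on the list of edges *)

Section edge_action.
Variables (R : realType) (n d : nat).
Implicit Types (A : 'M[R]_n) (x : 'rV[R]_(n * d)).

(** In flattened coordinates the entry of [lin_mulmx A] at row (i, s) and column (j, t) is [A j i]
    if s = t and 0 otherwise, so transposing it transposes [A]. *)
Lemma trmx_lin_mulmx A :
  (lin_mulmx A : 'M[R]_(n * d))^T = lin_mulmx A^T.
Proof.
apply/matrixP => p q; case/mxvec_indexP: p => i s; case/mxvec_indexP: q => j t.
rewrite /lin_mulmx /lin_mx /lin1_mx !mxE /= !mxvecE !vec_mx_delta !mxE.
rewrite (bigD1 j)//= [in RHS](bigD1 i)//= !mxE !eqxx !big1 ?addr0.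
- by rewrite eq_sym.
- by move=> k /negPf ki; rewrite !mxE ki mulr0.
- by move=> k /negPf ki; rewrite !mxE ki mulr0.
Qed.

Lemma lin_mulmx_orthogonal A : A *m A^T = 1%:M ->
  (lin_mulmx A : 'M[R]_(n * d)) *m (lin_mulmx A)^T = 1%:M.
Proof.
move=> AA; apply/row_matrixP => p; rewrite !rowE mulmxA trmx_lin_mulmx mulmx1.
by rewrite !mul_rV_lin /= mxvecK mulmxA (mulmx1C AA) mul1mx vec_mxK.
Qed.

Lemma edge_lin_mulmx A x i :
  edge (x *m lin_mulmx A) i = \sum_(k < n) A i k *: edge x k.
Proof.
rewrite /edge mul_rV_lin mxvecK row_mul mulmx_sum_row.
by apply: eq_bigr => k _; rewrite mxE.
Qed.

Lemma edge_perm (s : 'S_n) x i :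
  edge (x *m lin_mulmx (perm_mx s)) i = edge x (s i).
Proof.
rewrite edge_lin_mulmx (bigD1 (s i))//= big1 => [|k /negPf ks].
  by rewrite !mxE eqxx scale1r addr0.
by rewrite !mxE eq_sym ks scale0r.
Qed.

Definition flip_mx (i : 'I_n) : 'M[R]_n :=
  diag_mx (\row_j (if j == i then -1 else 1)).

Lemma edge_flip i x j :
  edge (x *m lin_mulmx (flip_mx i)) j = if j == i then - edge x j else edge x j.
Proof.
rewrite edge_lin_mulmx (bigD1 j)//= big1 => [|k /negPf kj].
  by rewrite !mxE eqxx addr0; case: ifP => _; rewrite ?scaleN1r ?scale1r.
by rewrite !mxE [j == k]eq_sym kj mulr0n scale0r.
Qed.

End edge_action.

(** * Expectations of inner products of edges *)

Lemma integral_eq_on (disp : measure_display) (T : measurableType disp)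
    (R : realType) (mu : {measure set T -> \bar R}) (A : set T)
    (f g : T -> \bar R) :
  measurable A -> mu (~` A) = 0 ->
  measurable_fun setT f -> measurable_fun setT g -> {in A, f =1 g} ->
  (\int[mu]_x f x = \int[mu]_x g x)%E.
Proof.
move=> mA muA mf mg fg; apply: ae_eq_integral => //.
exists (~` A); split=> //; first exact: measurableC.
by move=> x /= nfg Ax; apply: nfg => _; exact/fg/mem_set.
Qed.

Section edge_integrals.
Variables (R : realType) (n d : nat) (P : probability (borel_rV R (n * d)) R).
Local Notation dotE i j :=
  (EFin \o edge_dot i j : borel_rV R (n * d) -> \bar R).
Local Notation arm := (@eArm R n d : set (borel_rV R (n * d))).

Lemma closed_eArm : closed (@eArm R n d).
Proof.
have -> : @eArm R n d =
    \bigcap_i ((fun x => edge x i) @^-1` sphere (2%:R / n%:R)).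
  by apply/seteqP; split=> [x Ax i _|x Ax i]; apply: Ax.
apply: closed_bigI => i _; apply: preimage_closed; last exact: closed_sphere.
by move=> x _; exact: continuous_edge.
Qed.

Lemma measurable_edge_dot i j :
  measurable_fun setT (dotE i j).
Proof.
apply/measurable_EFinP.
exact: (continuous_measurable_rV_R (@continuous_edge_dot R n d i j)).
Qed.

Hypothesis P_arm : P (~` arm) = 0.

Let mA : measurable arm.
Proof. exact: closed_measurable_rV closed_eArm. Qed.

(** The inner product is bounded on the arm space, and the complement of that space is a null
    set. *)
Lemma integrable_edge_dot i j : P.-integrable setT (dotE i j).
Proof.
have mf := measurable_edge_dot i j.
apply/(negligible_integrable (measurableC mA) measurableT mf P_arm).
rewrite setTD setCK; apply: measurable_bounded_integrable => //.
- by rewrite (le_lt_trans (probability_le1 P mA))// ltry.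
- apply: measurable_funTS.
  exact: (continuous_measurable_rV_R (@continuous_edge_dot R n d i j)).
- exists (d%:R * (2 / n%:R) ^+ 2); split; first exact: num_real.
  by move=> M lM x Ax; apply: le_trans (ltW lM); exact: edge_dot_eArm.
Qed.

Lemma integral_edge_dot_diag i :
  (\int[P]_x (edge_dot i i x)%:E = ((2 / n%:R) ^+ 2)%:E)%E.
Proof.
rewrite (@integral_eq_on _ _ _ P arm _ (cst ((2 / n%:R) ^+ 2)%:E))//.
- by rewrite integral_cst//= probability_setT mule1.
- exact: measurable_edge_dot.
- by move=> x /set_mem Ax; rewrite edge_dot_diag Ax.
Qed.

(** Change of variables along a symmetry of [P]. It serves with [s = -1] for the flip of an edge and
    with [s = 1] for a permutation of edges. *)
Lemma integral_edge_dot_mulmxr (Q : 'M[R]_(n * d)) i j i' j' :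
  (forall B, measurable B -> P (mulmxr_borel Q @^-1` B) = P B) ->
  forall s : R, (forall x, edge_dot i j (x *m Q) = s * edge_dot i' j' x) ->
  (\int[P]_x (edge_dot i j x)%:E = s%:E * \int[P]_x (edge_dot i' j' x)%:E)%E.
Proof.
move=> PQ s sE.
have mQ := measurable_mulmxr_borel Q.
have fQ : dotE i j \o mulmxr_borel Q =
    fun x => (s%:E * (edge_dot i' j' x)%:E)%E.
  by apply/funext => x /=; rewrite sE EFinM.
have int' := integrable_edge_dot i' j'.
rewrite -integralZl// -fQ.
have intQ :
    P.-integrable (mulmxr_borel Q @^-1` setT) (dotE i j \o mulmxr_borel Q).
  by rewrite preimage_setT fQ; exact: integrableZl.
have := integral_pushforward mQ (measurable_edge_dot i j) intQ measurableT.
rewrite preimage_setT => <-.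
by apply: eq_measure_integral => B mB _; rewrite -[LHS]PQ.
Qed.

(** Linearity of the integral reduces both expectations to the pair [a], [c]; arms use [m = n.+1]
    and polygons [m = n]. *)
Lemma expectation_gyradius (m : nat) (v1 : 'rV[R]_d) (a c : R) :
  (m <= n.+1)%N ->
  (forall k l,
    \int[P]_x (edge_dot k l x)%:E = (if k == l then a else c)%:E)%E ->
  ('E_P[gyradius m v1] = ((2 * m%:R ^+ 2)^-1 *
    ((a - c) * (m%:R * (m%:R ^+ 2 - 1) / 3) +
     c * (m%:R ^+ 2 * (m%:R ^+ 2 - 1) / 6)))%:E)%E.
Proof.
move=> mn Edot; rewrite unlock -(sum_step_weight_quadratic _ _ mn).
under eq_integral => x _.
  rewrite gyradiusE -sumEFin; under eq_bigr => i _.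
    rewrite -sumEFin; under eq_bigr => j _.
      rewrite -sumEFin; under eq_bigr => k _.
        rewrite -sumEFin; under eq_bigr do rewrite EFinM.
        over.
      over.
    over.
  over.
have idot (i j : nat) (k l : 'I_n) :
    P.-integrable setT (fun x => ((2 * m%:R ^+ 2)^-1 *
    (step_weight R i j k * step_weight R i j l))%:E * (edge_dot k l x)%:E)%E.
  exact/integrableZl/integrable_edge_dot.
rewrite integral_sum//; last first.
  by move=> i; do 3![apply: integrable_sum => // ? _].
rewrite mulr_sumr -sumEFin; apply: eq_bigr => i _.
rewrite integral_sum//; last first.
  by move=> j; do 2![apply: integrable_sum => // ? _].
rewrite mulr_sumr -sumEFin; apply: eq_bigr => j _.
rewrite integral_sum//; last by move=> k; apply: integrable_sum => // ? _.
rewrite mulr_sumr -sumEFin; apply: eq_bigr => k _.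
rewrite integral_sum// mulr_sumr -sumEFin; apply: eq_bigr => l _.
rewrite integralZl//; last exact: integrable_edge_dot.
by rewrite Edot -EFinM; congr EFin; rewrite -[LHS]mulrA.
Qed.

End edge_integrals.

(** * Arms: symmetries of the product measure *)

Section arm.
Variables (R : realType) (n d : nat).
Local Notation borel := (borel_rV R (n * d)).

Definition edge_rect (A : 'I_n -> set (borel_rV R d)) : set borel :=
  [set x | forall i, A i (edge x i)].

Definition edge_rects : set (set borel) :=
  [set edge_rect A | A in [set A | forall i, measurable (A i)]].

Lemma measurable_edge_rect A :
  (forall i, measurable (A i)) -> measurable (edge_rect A).
Proof.
move=> mA; have -> : edge_rect A =
    \bigcap_(i in [set: 'I_n])
      ((fun x : borel => edge x i : borel_rV R d) @^-1` A i).
  by apply/seteqP; split=> [x Ax i _|x Ax i]; apply: Ax.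
apply: fin_bigcap_measurable => // i _; rewrite -[X in measurable X]setTI.
exact: (continuous_measurable_rV (@continuous_edge R n d i)).
Qed.

Lemma rat_ball_edge_rect (c : 'rV[rat]_(n * d) * nat) :
  rat_ball R c = edge_rect (fun i =>
    ball (edge (map_mx ratr c.1 : 'rV[R]_(n * d)) i) c.2.+1%:R^-1).
Proof.
apply/seteqP; split=> [x [r0 cx]|x cx].
  by move=> i; split=> // p t; rewrite (ord1 p) !edgeE; exact: cx.
split=> [|p q]; first by rewrite /= invr_gt0.
rewrite (ord1 p); case/mxvec_indexP: q => i t.
by rewrite -!edgeE; have [_] := cx i; apply.
Qed.

(** A ball of the sup norm is a rectangle of balls, and every open set is a countable union of
    rational balls. With [edge_rects_setI], the rectangles form a generating pi-system. *)
Lemma measurable_edge_rects : @measurable _ borel = <<s edge_rects >>.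
Proof.
apply/seteqP; split; apply: smallest_sub; try exact: smallest_sigma_algebra.
- move=> B /open_bigcup_rat_ball ->.
  apply: (@countable_bigcupT_measurable _ (g_sigma_algebraType edge_rects)).
    exact: countableP.
  move=> c; case: asboolP => _; last exact: measurable0.
  rewrite rat_ball_edge_rect; apply: sub_sigma_algebra.
  eexists; last reflexivity.
  by move=> i; apply: open_measurable_rV; exact: ball_open.
- by move=> _ [A mA <-]; exact: measurable_edge_rect.
Qed.

Lemma edge_rects_setI : setI_closed edge_rects.
Proof.
move=> _ _ [A mA <-] [B mB <-]; exists (fun i => A i `&` B i).
  by move=> i; exact: measurableI.
by apply/seteqP; split=> [x AB|x [Ax Bx] i]; [split=> i; have [] := AB i|split].
Qed.

Variables (sigma : probability (borel_rV R d) R) (P : probability borel R).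
Hypothesis sigma_vol : normalized_volume (sphere (2%:R / n%:R)) sigma.
Hypothesis P_prod : product_probability sigma P.

Lemma product_probability_arm : P (~` (@eArm R n d : set borel)) = 0.
Proof.
have mS : measurable (sphere (2%:R / n%:R) : set (borel_rV R d)).
  exact: closed_measurable_rV (@closed_sphere _ _ _).
have S1 : (sigma (sphere (2%:R / n%:R)) = 1)%E.
  rewrite -[X in sigma X]setCK probability_setC; last exact: measurableC.
  rewrite [X in (_ - X)%E](_ : _ = 0) ?sube0//.
  exact: normalized_volume_support (@closed_sphere _ _ _) sigma_vol.
rewrite probability_setC; last exact: closed_measurable_rV (@closed_eArm _ _ _).
rewrite (P_prod (A := fun=> sphere (2%:R / n%:R)))// big1 ?subee//.
Qed.

(** Here [P] is specified by its values on rectangles, so invariance comes from the factor [sigma],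
    which is invariant under negation, and extends to all Borel sets by uniqueness of measures on a
    pi-system. *)
Lemma product_probability_flip i (B : set borel) : measurable B ->
  P (mulmxr_borel (lin_mulmx (flip_mx R i)) @^-1` B) = P B.
Proof.
move=> mB; set Q := lin_mulmx _.
have sigmaN (A : set (borel_rV R d)) : measurable A ->
    measurable [set y : borel_rV R d | A (- (y : 'rV_d))] /\
    sigma [set y : borel_rV R d | A (- (y : 'rV_d))] = sigma A.
  have -> : [set y : borel_rV R d | A (- (y : 'rV_d))] =
      mulmxr_borel (- 1%:M) @^-1` A.
    by apply/seteqP; split=> y /=; rewrite /mulmxr_borel mulmxN mulmx1.
  move=> mA; split; first exact: measurable_preimage_mulmxr.
  apply: (normalized_volume_mulmxr _ _ (@closed_sphere _ _ _) sigma_vol) => //.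
    by rewrite linearN /= trmx1 mulNmx mulmxN mulmx1 opprK.
  move=> x; rewrite mulmxN mulmx1 /sphere /= /enorm.
  by under eq_bigr do rewrite mxE sqrrN.
have mQ := measurable_mulmxr_borel Q.
unshelve apply: (measure_unique edge_rects (fun=> setT) measurable_edge_rects
  edge_rects_setI _ _ (pushforward P (mulmxr_borel Q)) P) => //.
- by move=> _; exists (fun=> setT) => //; apply/seteqP; split.
- by apply: bigcup_const; exists 0%N.
- move=> _ [A mA <-].
  (* The preimage of a rectangle under the flip is again a rectangle, with its [i]-th side
     negated. *)
  pose A' j :=
    if j == i then [set y : borel_rV R d | A j (- (y : 'rV_d))] else A j.
  transitivity (P (edge_rect A')).
    congr (P _).
    apply/seteqP; split=> x Ax j; have := Ax j; rewrite /A' /= edge_flip;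
      by case: (j == i).
  have mA' j : measurable (A' j).
    by rewrite /A'; case: ifP => // _; exact: (sigmaN _ _).1.
  rewrite (P_prod mA') [RHS](P_prod mA); apply: eq_bigr => j _.
  by rewrite /A'; case: ifP => // _; exact: (sigmaN _ _).2.
- move=> _; apply: (@le_lt_trans _ _ 1%E); last exact: ltry.
  by apply: probability_le1; exact: measurable_preimage_mulmxr.
Qed.

End arm.

Lemma eArm_expectation (R : realType) (n d : nat) (v1 : 'rV[R]_d)
    (P : probability (borel_rV R (n * d)) R) :
  (0 < n)%N -> eArm_measure P ->
  ('E_P[arm_gyradius v1] =
    (2%:R / 3%:R * ((n%:R + 2%:R) / (n%:R * (n%:R + 1))))%:E)%E.
Proof.
move=> n0 [sigma [sigma_vol P_prod]].
have P_arm := product_probability_arm sigma_vol P_prod.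
have dotE (k l : 'I_n) : (\int[P]_x (edge_dot k l x)%:E =
    (if k == l then (2 / n%:R) ^+ 2 else 0)%:E)%E.
  case: eqVneq => [->|kl]; first exact: integral_edge_dot_diag.
  have flip := integral_edge_dot_mulmxr (i := k) (j := l) (i' := k) (j' := l)
    P_arm (product_probability_flip sigma_vol P_prod k) (s := -1).
  (* Flipping edge [k] shows that the integral equals its own negative; finiteness is needed to
     conclude that it is 0. *)
  have /fineK <- : (\int[P]_x (edge_dot k l x)%:E)%E \is a fin_num.
    exact: integrable_fin_num (integrable_edge_dot P_arm k l).
  congr EFin.
  have /(congr1 fine) : (\int[P]_x (edge_dot k l x)%:E =
      (-1)%:E * \int[P]_x (edge_dot k l x)%:E)%E.
    apply: flip => x; rewrite /edge_dot mulr_sumr; apply: eq_bigr => t _.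
    by rewrite !edge_flip eqxx eq_sym (negPf kl) mxE; ring.
  rewrite fineM//=; first by lra.
  exact: integrable_fin_num (integrable_edge_dot P_arm k l).
rewrite /arm_gyradius (expectation_gyradius P_arm v1 _ dotE)//; congr EFin.
have nR : n%:R != 0 :> R by rewrite pnatr_eq0 -lt0n.
have n1R : n%:R + 1 != 0 :> R by rewrite natr1 pnatr_eq0.
by rewrite -natr1; field; rewrite nR n1R.
Qed.

(** * Closed polygons: exchangeability of the edges *)

Section polygon.
Variables (R : realType) (n d : nat) (P : probability (borel_rV R (n * d)) R).
Local Notation pol := (@ePol R n d : set (borel_rV R (n * d))).

Lemma closed_ePol : closed (@ePol R n d).
Proof.
have -> : @ePol R n d = @eArm R n d `&`
    (fun x => \sum_(i < n) edge x i) @^-1` [set y | y = 0] by [].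
apply: closedI; first exact: closed_eArm.
apply: preimage_closed; last first.
  (* The origin is the sphere of radius 0, so closedness of spheres applies. *)
  have -> : [set y : 'rV[R]_d | y = 0] = sphere 0.
    apply/seteqP; split=> [y ->|y /= y0].
      by rewrite /sphere /= /enorm big1 ?sqrtr0// => t _; rewrite mxE expr0n.
    apply/rowP => t; rewrite mxE; apply/eqP; rewrite -sqrf_eq0.
    have := sqr_enorm y; rewrite y0 expr0n => /esym/eqP.
    rewrite psumr_eq0 => [/allP/(_ t)|s _]; last exact: sqr_ge0.
    by apply; rewrite mem_index_enum.
  exact: closed_sphere.
move=> x _; apply: continuous_mx => p t.
under eq_fun do rewrite summxE.
by apply: continuous_sum => i; rewrite (ord1 p); exact: continuous_edge_coord.
Qed.

Hypothesis P_vol : ePol_measure P.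

Lemma ePol_measure_support : P (~` pol) = 0.
Proof. exact: normalized_volume_support closed_ePol P_vol. Qed.

(** Permuting edges is orthogonal on the flattened space and preserves both the lengths and the sum
    of the edges. *)
Lemma ePol_measure_perm (s : 'S_n) (B : set (borel_rV R (n * d))) :
  measurable B -> P (mulmxr_borel (lin_mulmx (perm_mx s)) @^-1` B) = P B.
Proof.
apply: (normalized_volume_mulmxr _ _ closed_ePol P_vol).
  by apply: lin_mulmx_orthogonal; rewrite tr_perm_mx -perm_mxM mulgV perm_mx1.
move=> x; rewrite /ePol /eArm /=.
have -> : \sum_(i < n) edge (x *m lin_mulmx (perm_mx s)) i =
    \sum_(i < n) edge x i.
  rewrite [RHS](reindex_inj (@perm_inj _ s)) /=.
  by apply: eq_bigr => i _; rewrite edge_perm.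
split=> -[Ax x0]; split=> // i; last by rewrite edge_perm; exact: Ax.
by rewrite -[i](permKV s) -edge_perm; exact: Ax.
Qed.

Let P_arm : P (~` (@eArm R n d : set (borel_rV R (n * d)))) = 0.
Proof.
have mA : measurable (@eArm R n d : set (borel_rV R (n * d))).
  exact: closed_measurable_rV (@closed_eArm _ _ _).
have mp : measurable pol by exact: closed_measurable_rV closed_ePol.
apply: (@subset_measure0 _ _ _ P _ (~` pol)).
- exact: measurableC.
- exact: measurableC.
- by apply: subsetC => x [].
- exact: ePol_measure_support.
Qed.

(** On closed polygons the sum over [l] is the inner product of edge [k] with the zero vector. *)
Lemma ePol_integral_sum (k : 'I_n) :
  (\sum_(l < n) \int[P]_x (edge_dot k l x)%:E = 0)%E.
Proof.
rewrite -integral_sum//; last by move=> l; exact: integrable_edge_dot.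
rewrite (@integral_eq_on _ _ _ P pol _ (cst 0%E)) ?integral0//.
- exact: closed_measurable_rV closed_ePol.
- exact: ePol_measure_support.
- by apply: emeasurable_sum => l _; exact: measurable_edge_dot.
move=> x /set_mem[_ x0].
rewrite sumEFin /edge_dot exchange_big /= big1// => t _.
have := congr1 (fun y : 'rV_d => y 0 t) x0.
by rewrite -mulr_sumr summxE mxE => ->; rewrite mulr0.
Qed.

Lemma ePol_integral_off_diag (k l : 'I_n) : k != l ->
  (\int[P]_x (edge_dot k l x)%:E = (- (2 / n%:R) ^+ 2 / (n%:R - 1))%:E)%E.
Proof.
move=> kl.
have offE (m : 'I_n) : m != k ->
    (\int[P]_x (edge_dot k m x)%:E = \int[P]_x (edge_dot k l x)%:E)%E.
  move=> mk; rewrite -[RHS]mul1e.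
  (* The transposition of [l] and [m] fixes [k], since [k] differs from both. *)
  apply: (integral_edge_dot_mulmxr P_arm (ePol_measure_perm (tperm l m))) => x.
  rewrite mul1r; apply: eq_bigr => t _.
  by rewrite !edge_perm tpermR tpermD// eq_sym.
have := ePol_integral_sum k; rewrite (bigD1 k)//= integral_edge_dot_diag//.
rewrite (eq_bigr _ offE).
have /fineK <- : (\int[P]_x (edge_dot k l x)%:E)%E \is a fin_num.
  exact: integrable_fin_num (integrable_edge_dot P_arm k l).
set e := fine _; rewrite sumEFin -EFinD => -[].
(* The relation is (2 / n)^2 + (n - 1) e = 0; two distinct indices force n > 1, so it can be solved
   for [e]. *)
rewrite sumr_const cardC1 card_ord -[e *+ _]mulr_natr.
have n1 : (1 < n)%N.
  by have := ltn_ord k; have := ltn_ord l; move: kl; rewrite -val_eqE /=; lia.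
rewrite -subn1 natrB ?(ltnW n1)// => E; congr EFin.
have n1R : n%:R - 1 != 0 :> R by rewrite subr_eq0 pnatr_eq1 gtn_eqF.
apply: (mulIf n1R); rewrite divfK//; lra.
Qed.

(** A single edge of positive length cannot close up: for [n = 1] the sum of integrals would be both
    0 and (2 / n)^2. This makes [n - 1] invertible in the final computation. *)
Lemma ePol_edges_gt1 : (0 < n)%N -> (1 < n)%N.
Proof.
move=> n0; rewrite ltn_neqAle n0 andbT; apply/eqP => n1.
have := ePol_integral_sum (Ordinal n0); rewrite (bigD1 (Ordinal n0))//= big1.
  rewrite adde0 integral_edge_dot_diag// => -[] /eqP.
  by rewrite sqrf_eq0 mulf_eq0 invr_eq0 !pnatr_eq0 /= eqn0Ngt n0.
move=> [l ln]; rewrite -val_eqE /=; lia.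
Qed.

Lemma ePol_expectation (v1 : 'rV[R]_d) : (0 < n)%N ->
  ('E_P[pol_gyradius v1] = (1 / 3%:R * ((n%:R + 1) / n%:R ^+ 2))%:E)%E.
Proof.
move=> n0; have n1 := ePol_edges_gt1 n0.
have dotE (k l : 'I_n) : (\int[P]_x (edge_dot k l x)%:E =
    (if k == l then (2 / n%:R) ^+ 2 else - (2 / n%:R) ^+ 2 / (n%:R - 1))%:E)%E.
  case: eqVneq => [->|kl]; first exact: integral_edge_dot_diag.
  exact: ePol_integral_off_diag.
rewrite /pol_gyradius (expectation_gyradius P_arm v1 (leqnSn n) dotE).
congr EFin.
have nR : n%:R != 0 :> R by rewrite pnatr_eq0 -lt0n.
have n1R : n%:R - 1 != 0 :> R by rewrite subr_eq0 pnatr_eq1 gtn_eqF.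
by field; rewrite nR n1R.
Qed.

End polygon.

Unset Implicit Arguments.

Theorem proposition22 (R : realType) (d n : nat) (hd : d = 2%N \/ d = 3%N)
    (hn : (0 < n)%N) (v1 : 'rV[R]_d) :
  (forall P : probability (borel_rV R (n * d)) R, eArm_measure P ->
     ('E_P[arm_gyradius v1] =
        (2%:R / 3%:R * ((n%:R + 2%:R) / (n%:R * (n%:R + 1))))%:E)%E) /\
  (forall P : probability (borel_rV R (n * d)) R, ePol_measure P ->
     ('E_P[pol_gyradius v1] =
        (1 / 3%:R * ((n%:R + 1) / n%:R ^+ 2))%:E)%E).
Proof.
split=> P HP; first exact: eArm_expectation.
exact: ePol_expectation.
Qed.
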